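(* Let $G$ be a finite simple graph with at least one vertex and degeneracy $p$. For each $i\in\{\delta(G),\dots,p\}$ let $C_i$ be the set of cheap vertices $v$ of $G$ with $\zeta(v)=i$, and for each such $i$ with $C_i\neq\varnothing$ let $S_i$ be any nonempty independent set of $G[C_i]$. Define $\lambda_i=1-\frac{e_i}{|S_i|}+\frac{|N(S_i)|}{|S_i|}$, where $e_i$ is the number of edges of $G$ between $S_i$ and $N(S_i)$. Let $j$ be an index with $\lambda_j=\min_i\lambda_i$ (minimum over the indices $i$ for which $S_i$ is defined), and set $\lambda=\lambda_j$, $S=S_j$. Then $$\alpha(G)\geq \sum_{v\in N[S]}\frac{1}{\zeta(v)+\lambda}+\sum_{v\in V(G)\setminus N[S]}\frac{1}{\zeta(v)+1}.$$
   Context: $\alpha(G)$ is the independence number; $\delta(G)$ is the minimum degree. For a vertex $v$, $\zeta(v)=\max_H\delta(H)$, the maximum over all subgraphs $H$ of $G$ containing $v$. The degeneracy of $G$ is $\max_{H\subseteq G}\delta(H)$. For $X\subseteq V(G)$, $N(X)=\bigcup_{v\in X}N(v)$, $N[X]=N(X)\cup X$. A vertex $u$ is cheap if $\zeta(u)=\deg_G(u)$ and $\zeta(u)=\min_{v\in N[u]}\zeta(v)$. *)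

(* Defs.v *)
From mathcomp Require Import all_boot all_order all_algebra.

Set Implicit Arguments.
Unset Strict Implicit.
Unset Printing Implicit Defensive.

Import GRing.Theory Num.Theory.

(* A graph is a pair (vertex set, edge set) over a finite ground type T, each
   edge being the set of its two ends; G and all its subgraphs then live in the
   same finite type.  [simple_graph] is the well-formedness condition. *)
Notation graph T := ({set T} * {set {set T}})%type.

Section Graphs.
Variable T : finType.
Implicit Types (G H : graph T) (v : T) (A B S X U : {set T}).

Definition vertices G : {set T} := G.1.
Definition edges G : {set {set T}} := G.2.

Definition simple_graph G : bool :=
  [forall e in edges G, (#|e| == 2) && (e \subset vertices G)].

Definition subgraph H G : bool :=
  [&& simple_graph H, vertices H \subset vertices G & edges H \subset edges G].

Definition induced G U : graph T :=
  (vertices G :&: U, [set e in edges G | e \subset U]).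

Definition neighbors G v : {set T} := [set u | [set v; u] \in edges G].

Definition open_nbhd G X : {set T} := \bigcup_(v in X) neighbors G v.

Definition closed_nbhd G X : {set T} := open_nbhd G X :|: X.

Definition degree G v : nat := #|neighbors G v|.

(* The default #|T| bounds every degree, so this is the true minimum as soon as
   H has a vertex; it is junk on the null graph, which is excluded below. *)
Definition min_degree H : nat := \big[minn/#|T|]_(v in vertices H) degree H v.

Definition degeneracy G : nat :=
  \max_(H : graph T | subgraph H G && (vertices H != set0)) min_degree H.

Definition zeta G v : nat :=
  \max_(H : graph T | subgraph H G && (v \in vertices H)) min_degree H.

(* In the minimum over N[u], the default zeta G u is one of the terms. *)
Definition cheap G v : bool :=
  [&& v \in vertices G,
      zeta G v == degree G v
    & zeta G v == \big[minn/zeta G v]_(w in closed_nbhd G [set v]) zeta G w].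

Definition cheap_level G (i : nat) : {set T} :=
  [set v | cheap G v & zeta G v == i].

Definition independent G S : bool :=
  (S \subset vertices G) && [forall e in edges G, ~~ (e \subset S)].

Definition independence_number G : nat :=
  \max_(S : {set T} | independent G S) #|S|.

Definition edges_between G A B : {set {set T}} :=
  [set e in edges G | [exists a in A, exists b in B, e == [set a; b]]].

Local Open Scope ring_scope.

Definition lambda G S : rat :=
  1 - #|edges_between G S (open_nbhd G S)|%:R / #|S|%:R
    + #|open_nbhd G S|%:R / #|S|%:R.

End Graphs.

(* Main.v *)
(** Every vertex of N[S] has zeta at least j because S consists of cheap
    vertices, and at most j|S| edges leave S, so j + lambda >= |N[S]|/|S| and the
    first sum is at most |S|.  Outside N[S] a greedy choice works: picking a
    vertex of minimum degree d in the graph induced by the remaining vertices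
    deletes d + 1 vertices, all with zeta >= d, hence of total weight at most 1.
    The union of S with the greedy set is independent. *)
Require Import Defs.
From mathcomp Require Import all_boot all_order all_algebra.
From mathcomp Require Import lra.

Set Implicit Arguments.
Unset Strict Implicit.
Unset Printing Implicit Defensive.

Import Order.TTheory GRing.Theory Num.Theory.

Local Open Scope ring_scope.

(** Taking [c] equal to [#|A|] gives the bound 1, which pays for one greedy step; taking [c] equal
    to [#|A|] divided by [s] gives the bound [s], which handles the closed neighborhood of the cheap
    set. *)
Lemma sum_inv_le_card (I : finType) (R : numFieldType) (A : {set I})
    (f : I -> R) (c : R) :
  0 < c -> (forall v, v \in A -> c <= f v) ->
  \sum_(v in A) (f v)^-1 <= #|A|%:R / c.
Proof.
move=> c_gt0 le_c_f.
have -> : #|A|%:R / c = \sum_(v in A) c^-1 by rewrite sumr_const mulr_natl.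
apply: ler_sum => v /le_c_f le_c_fv.
by rewrite lef_pV2 ?posrE ?(lt_le_trans c_gt0).
Qed.

Section Graphs.
Variables (T : finType) (G : graph T).
Hypothesis G_simple : simple_graph G.
Implicit Types (u v w : T) (A B U : {set T}).

Lemma edgeP (e : {set T}) : e \in edges G ->
  exists u v, [/\ u != v, e = [set u; v] & e \subset vertices G].
Proof.
move=> eG; have /forall_inP/(_ e eG)/andP[/cards2P e2 sub] := G_simple.
by have [u [v [uv Ee]]] := e2; exists u, v.
Qed.

Lemma neighbors_irrefl v : v \notin neighbors G v.
Proof.
rewrite inE; apply/negP => /edgeP[a [b [ab Eab _]]].
by have := cards2 a b; rewrite -Eab ab setUid cards1.
Qed.

Lemma open_nbhd1 u : open_nbhd G [set u] = neighbors G u.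
Proof. by rewrite /open_nbhd big_set1. Qed.

Lemma simple_induced U : simple_graph (induced G U).
Proof.
apply/forall_inP => e; rewrite inE => /andP[eG eU].
have /forall_inP/(_ e eG)/andP[-> sub] := G_simple.
by rewrite subsetI sub eU.
Qed.

Lemma subgraph_induced U : subgraph (induced G U) G.
Proof.
rewrite /subgraph simple_induced subsetIl.
by apply/subsetP => e; rewrite inE => /andP[].
Qed.

Lemma neighbors_induced U u :
  u \in U -> neighbors (induced G U) u = neighbors G u :&: U.
Proof. by move=> uU; apply/setP=> w; rewrite !inE subUset !sub1set uU. Qed.

Lemma independent_of_induced U A :
  independent (induced G U) A -> independent G A /\ A \subset U.
Proof.
case/andP; rewrite subsetI => /andP[AG AU] /forall_inP indA; split=> //.
rewrite /independent AG; apply/forall_inP => e eG; apply/negP => eA.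
have := indA e; rewrite inE eG (subset_trans eA AU) eA.
by move/(_ isT).
Qed.

Lemma independent1 u : u \in vertices G -> independent G [set u].
Proof.
move=> uG; rewrite /independent sub1set uG; apply/forall_inP => e.
case/edgeP=> a [b [ab -> _]]; rewrite subUset !sub1set !inE.
by apply: contra ab => /andP[/eqP-> /eqP->].
Qed.

(** Only an edge with one end in each set could do harm, and it would put its end in [B] among the
    neighbors of [A]. *)
Lemma independentU A B :
  independent G A -> independent G B -> [disjoint B & open_nbhd G A] ->
  independent G (A :|: B).
Proof.
case/andP=> AG /forall_inP indA /andP[BG /forall_inP indB] dis.
have cross a b : a \in A -> b \in B -> [set a; b] \notin edges G.
  move=> aA bB; apply: contraFN (disjointFr dis bB) => abG.
  by apply/bigcupP; exists a; rewrite // inE.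
rewrite /independent subUset AG BG; apply/forall_inP => e eG.
have [a [b [_ Ee _]]] := edgeP eG; subst e.
have := indA _ eG; have := indB _ eG; rewrite !subUset !sub1set !inE.
move=> nB nA; apply/negP => /andP[].
case/orP=> [aA|aB] /orP[bA|bB].
- by rewrite aA bA in nA.
- by have := cross _ _ aA bB; rewrite eG.
- by have := cross _ _ bA aB; rewrite setUC eG.
- by rewrite aB bB in nB.
Qed.

Lemma min_degree_le_zeta (H : graph T) v :
  subgraph H G -> v \in vertices H -> (min_degree H <= zeta G v)%N.
Proof.
by move=> HG vH; apply: (@leq_bigmax_cond _ _ (@min_degree T)); rewrite HG.
Qed.

Lemma greedy_independent U : U \subset vertices G ->
  exists A, [/\ independent G A, A \subset U
    & \sum_(v in U) ((zeta G v)%:R + 1)^-1 <= #|A|%:R :> rat].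
Proof.
have [n] := ubnP #|U|; elim: n U => // n IHn U ltUn UG.
have [->|/set0Pn[u0 u0U]] := eqVneq U set0.
  exists set0; rewrite big_set0 cards0 sub0set /independent sub0set; split=> //.
  apply/forall_inP => e /edgeP[a [b [_ -> _]]].
  by rewrite subUset sub1set inE.
pose H := induced G U.
have [u u_in u_min] := arg_minnP (degree H) u0U.
have uU : u \in U by [].
have uG : u \in vertices G by apply: (subsetP UG).
pose d := degree H u.
have d_zeta v : v \in U -> (d <= zeta G v)%N.
  (* The induced graph [H] contains [v], so it competes in the maximum defining [zeta G v], and its
     minimum degree is [d]. The default [#|T|] of that minimum must be bounded below by [d] too. *)
  move=> vU; apply: leq_trans (min_degree_le_zeta (subgraph_induced U) _).
    rewrite /min_degree -minEnat -leEnat.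
    apply: le_bigmin => [|w]; first exact: max_card.
    by rewrite inE => /andP[_]; apply: u_min.
  by rewrite inE vU (subsetP UG).
pose N := closed_nbhd G [set u].
have cardUN : #|U :&: N| = d.+1.
  have -> : U :&: N = u |: neighbors H u.
    rewrite neighbors_induced // /N /closed_nbhd open_nbhd1.
    apply/setP => w; rewrite !inE.
    by have [->|_] := eqVneq w u; [rewrite uU orbT | rewrite orbF andbC].
  rewrite cardsU1; suff -> : u \notin neighbors H u by [].
  by rewrite neighbors_induced // in_setI negb_and neighbors_irrefl.
have ltUN : (#|U :\: N| < n)%N.
  rewrite -ltnS (leq_trans _ ltUn) // ltnS -(cardsID N U) cardUN addSn ltnS.
  exact: leq_addl.
have [A [indA AUN leA]] := IHn _ ltUN (subset_trans (subsetDl U N) UG).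
have /subsetDP[AU disAN] := AUN.
have uA : u \notin A by rewrite (disjointFl disAN) // !inE eqxx orbT.
exists (u |: A); split.
- apply: independentU => //; first exact: independent1.
  by apply: disjointWr disAN; apply: subsetUl.
- by rewrite subUset sub1set uU.
(* The [d.+1] terms over [U :&: N] are each at most 1/(d+1), so the new vertex [u] pays for them;
   [leA] covers the rest. *)
rewrite (big_setID N) cardsU1 uA natrD lerD //=.
have := @sum_inv_le_card _ rat (U :&: N) (fun v => (zeta G v)%:R + 1) d.+1%:R.
rewrite cardUN divff ?pnatr_eq0 //; apply; first by rewrite ltr0n.
by move=> v /setIP[vU _]; rewrite natr1 ler_nat ltnS d_zeta.
Qed.

(** Each edge is charged to an end in [A]; an edge with both ends in [A] may be charged twice, hence
    an inequality. *)
Lemma card_edges_between_le A B :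
  (#|edges_between G A B| <= \sum_(v in A) degree G v)%N.
Proof.
have sub : edges_between G A B \subset
    \bigcup_(v in A) [set [set v; b] | b in neighbors G v].
  apply/subsetP => e; rewrite inE => /andP[eG /exists_inP[a aA]].
  case/exists_inP=> b _ /eqP Ee; apply/bigcupP; exists a => //.
  by rewrite Ee; apply: imset_f; rewrite inE -Ee.
apply: leq_trans (subset_leq_card sub) _.
elim/big_rec2: _ => [|v m X _ le_Xm]; first by rewrite cards0.
apply: leq_trans (leq_card_setU _ _).1 _.
by rewrite leq_add ?leq_imset_card.
Qed.

Lemma cheap_le_zeta u v :
  cheap G u -> v \in closed_nbhd G [set u] -> (zeta G u <= zeta G v)%N.
Proof.
by case/and3P=> _ _ /eqP-> vN; rewrite -minEnat -leEnat; apply: bigmin_le_cond.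
Qed.

Lemma level_le_zeta (i : nat) A v :
  A \subset cheap_level G i -> v \in closed_nbhd G A -> (i <= zeta G v)%N.
Proof.
move=> /subsetP Ai; rewrite inE => /orP[/bigcupP[u uA vu]|/Ai]; last first.
  by rewrite inE => /andP[_ /eqP->].
have := Ai u uA; rewrite inE => /andP[u_cheap /eqP <-].
by apply: cheap_le_zeta => //; rewrite inE open_nbhd1 vu.
Qed.

(** The value of [lambda] is tuned so that |A|(i + lambda) = (i|A| - e) + |A| + |N(A)|, where e
    counts the edges leaving [A]. Once e is at most i|A|, this is at least |N[A]|. *)
Lemma sum_closed_nbhd_le (i : nat) A :
  A \subset cheap_level G i -> A != set0 ->
  \sum_(v in closed_nbhd G A) ((zeta G v)%:R + lambda G A)^-1 <= #|A|%:R.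
Proof.
move=> Ai A0; set s : rat := #|A|%:R; set N := closed_nbhd G A.
have s_gt0 : 0 < s by rewrite ltr0n card_gt0.
(* Since [lambda G A] can be negative, positivity of the denominators comes from their lower bound
   [#|N|%:R / s]. *)
have N_gt0 : 0 < #|N|%:R :> rat.
  by rewrite ltr0n (leq_trans _ (subset_leq_card (subsetUr _ A))) ?card_gt0.
(* Cheapness makes the degree of each vertex of [A] equal to its zeta value, which is [i]. *)
have e_le : (#|edges_between G A (open_nbhd G A)| <= i * #|A|)%N.
  rewrite mulnC -sum_nat_const; apply: leq_trans (card_edges_between_le _ _) _.
  apply: leq_sum => v /(subsetP Ai); rewrite inE.
  by case/andP=> /and3P[_ /eqP <- _] /eqP->.
have c_le : #|N|%:R / s <= i%:R + lambda G A.
  rewrite ler_pdivrMr // /lambda -/s.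
  rewrite !mulrDl mul1r mulNr !divfK ?gt_eqF //.
  have : #|N|%:R <= #|open_nbhd G A|%:R + s.
    by rewrite /s -natrD ler_nat (leq_card_setU _ _).1.
  have : #|edges_between G A (open_nbhd G A)|%:R <= i%:R * s.
    by rewrite /s -natrM ler_nat.
  lra.
have := @sum_inv_le_card _ rat N (fun v => (zeta G v)%:R + lambda G A) (#|N|%:R / s).
rewrite invf_div mulrCA divff ?gt_eqF // mulr1; apply; first exact: divr_gt0.
move=> v vN; apply: le_trans c_le _.
by rewrite lerD2r ler_nat (level_le_zeta Ai).
Qed.

End Graphs.

Theorem theorem3 (T : finType) (G : graph T)
    (G_simple : simple_graph G) (G_nonempty : vertices G != set0)
    (p : nat) (G_degen : degeneracy G = p)
    (S : nat -> {set T})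
    (S_spec : forall i : nat, (min_degree G <= i <= p)%N ->
       cheap_level G i != set0 ->
       S i != set0 /\ independent (induced G (cheap_level G i)) (S i))
    (j : nat) (j_range : (min_degree G <= j <= p)%N)
    (j_defined : cheap_level G j != set0)
    (j_min : forall i : nat, (min_degree G <= i <= p)%N ->
       cheap_level G i != set0 -> lambda G (S j) <= lambda G (S i)) :
  \sum_(v in closed_nbhd G (S j)) ((zeta G v)%:R + lambda G (S j))^-1
  + \sum_(v in vertices G :\: closed_nbhd G (S j)) ((zeta G v)%:R + 1)^-1
  <= (independence_number G)%:R :> rat.
Proof.
have [Sj0 /(independent_of_induced) [indS Sj_cheap]] := S_spec j j_range j_defined.
set N := closed_nbhd G (S j).
have [A [indA AU leA]] := greedy_independent G_simple (subsetDl (vertices G) N).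
have /subsetDP[_ disAN] := AU.
(* Avoiding [N] serves twice: its open part excludes edges between [S j] and [A], and its part [S j]
   makes the two sets disjoint, so their sizes add up. *)
have indSA : independent G (S j :|: A).
  by apply: independentU => //; apply: disjointWr disAN; apply: subsetUl.
have disSA : S j :&: A = set0.
  apply/disjoint_setI0; rewrite disjoint_sym; apply: disjointWr disAN.
  exact: subsetUr.
have le_alpha : (#|S j| + #|A| <= independence_number G)%N.
  rewrite -cardsUI disSA cards0 addn0.
  exact: (@leq_bigmax_cond _ (independent G) (fun X : {set T} => #|X|)).
apply: le_trans (lerD (sum_closed_nbhd_le Sj_cheap Sj0) leA) _.
by rewrite -natrD ler_nat.
Qed.
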